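(* Let $E$ be a Dedekind complete vector lattice. Suppose $S$ is a Dedekind complete distributive valuated lattice star containing $E$ as a lattice substar such that (i) there is an injective lattice semistar homomorphism from $\{s\vee x : s\in S,\ x\in E\}$ into the sup-completion $E^s$ of $E$, and (ii) $s=\sup\{\inf\{x-y : y\in[s^-]^{\leq}_+\} : x\in[s^+]^{\leq}_+\}$ for all $s\in S$. Then there is an injective lattice star homomorphism from $S$ into the sup-inf-completion $E^{si}$ of $E$.
   Context: Notation: $\mathbb{R}^+=[0,\infty)$; $E^+$ is the positive cone of $E$. Stars. A star is a set $S$ with a scalar multiplication $\mathbb{R}\times S\to S$ such that $\lambda(\mu x)=(\lambda\mu)x$, $1x=x$, and there is an element $0\in S$ with $0x=0$ for all $x\in S$. Write $-x:=(-1)x$. An ordered star is a star with a partial order such that $x\le y$ implies $\lambda x\le\lambda y$ for $\lambda\in\mathbb{R}^+$ and $-x\ge -y$. A lattice star is an ordered star in which $x\vee y$ and $x\wedge y$ exist for all $x,y$. It is distributive if $x\wedge(y\vee z)=(x\wedge y)\vee(x\wedge z)$ for all $x,y,z$. Put $x^+:=x\vee 0$, $x^-:=-(x\wedge 0)$, $|x|:=x\vee(-x)$; a lattice star is valuated if $|x|\ge 0$ for all $x$, and Dedekind complete if every nonempty subset that is bounded above has a supremum. A lattice substar is a subset closed under scalar multiplication, $\vee$ and $\wedge$; ''$S$ contains $E$ as a lattice substar'' means $E\subseteq S$ is such a subset with the scalar multiplication and lattice structure of $E$ inherited from $S$. A lattice star homomorphism is a map $\phi$ with $\phi(\lambda x)=\lambda\phi(x)$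 ($\lambda\in\mathbb{R}$) and $\phi(x\vee y)=\phi(x)\vee\phi(y)$. Semistars are defined like stars but with scalar multiplication by $\mathbb{R}^+$ only. A lattice semistar homomorphism is a map between lattice semistars preserving multiplication by scalars in $\mathbb{R}^+$ and the lattice operations $\vee,\wedge$. The set $\{s\vee x : s\in S, x\in E\}$ carries the structure inherited from $S$. For $0\le u\in S$ let $[u]^{\leq}_+:=\{x\in E^+ : x\le u\}$. In (ii), $x-y$ is computed in $E$, and suprema and infima are in $S$. Sup-completion. A cone is a commutative monoid with a scalar multiplication by $\mathbb{R}^+$ satisfying $\lambda(x+y)=\lambda x+\lambda y$, $(\lambda+\mu)x=\lambda x+\mu x$, $\lambda(\mu x)=(\lambda\mu)x$, $1x=x$, $0x=0$; a lattice cone is a cone with a lattice order compatible with addition and with multiplication by $\mathbb{R}^+$. $E^s$ is the essentially unique lattice cone $C$ such that: nonempty subsets of $C$ bounded above (below) have suprema (infima); $E$ is the set of additively invertible elements of $C$, with coinciding structures; $y=\sup\{x\in E: x\le y\}$ for $y\in C$; $z+(x\wedge y)=(z+x)\wedge(z+y)$ for $x\in E$, $y,z\in C$; $x\in E$, $y\in C$, $y\le x$ imply $y\in E$; $C$ has a largest element; and $\sup A=\sup B$ for nonempty $A,B\subseteq C$ implies $\sup(A\wedge x)=\sup(B\wedge x)$ for all $x\in E$. Sup-inf-completion. $E^{si}$ is (up to lattice star isomorphism) the lattice star $\{(x,y)\in E^s_+\times E^s_+ : x\wedge y=0\}$, where $E^s_+$ is the set of elements $\ge 0$ of $E^s$,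 with $\lambda(x,y)=(\lambda x,\lambda y)$ and $-\lambda(x,y)=(\lambda y,\lambda x)$ for $\lambda\in\mathbb{R}^+$, ordered by $(x,y)\le(z,w)$ iff $x\le z$ and $w\le y$. *)

(* Defs.v *)
From HB Require Import structures.
From mathcomp Require Import all_boot all_order all_algebra.
From mathcomp Require Import boolp classical_sets reals interval_inference.

Set Implicit Arguments.
Unset Strict Implicit.
Unset Printing Implicit Defensive.

Import Order.TTheory GRing.Theory Num.Theory.

Local Open Scope classical_set_scope.
Local Open Scope ring_scope.
Local Open Scope order_scope.

Definition dedekind_complete d (T : porderType d) : Prop :=
  forall A : set T, A !=set0 -> has_ubound A -> supremums A !=set0.

(* The library's hierarchy has no common substructure of its algebraic and its
   lattice structures below [realDomainType], so that a structure cannot inherit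
   from both.  The lattice operations are therefore fields here, and every
   vector lattice is made an instance of [latticeType] just below. *)
HB.mixin Record Lmodule_isVectorLattice (R : realType) E
    of GRing.Lmodule R E & Order.POrder ring_display E := {
  vjoin : E -> E -> E;
  vmeet : E -> E -> E;
  vlexI : forall x y z : E, (x <= vmeet y z) = (x <= y) && (x <= z);
  vleUx : forall x y z : E, (vjoin x y <= z) = (x <= z) && (y <= z);
  vle_add2r : forall z x y : E, x <= y -> x + z <= y + z;
  vle_scale : forall (a : R) (x y : E), 0 <= a -> x <= y -> a *: x <= a *: y
}.

#[short(type="vectorLatticeType")]
HB.structure Definition VectorLattice (R : realType) :=
  { E of GRing.Lmodule R E & Num.POrderedZmodule E
       & Lmodule_isVectorLattice R E }.

HB.instance Definition _ (R : realType) (E : vectorLatticeType R) :=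
  Order.POrder_MeetJoin_isLattice.Build ring_display (VectorLattice.sort E)
    (@vlexI R E) (@vleUx R E).

HB.mixin Record isStar (R : realType) S := {
  sscale : R -> S -> S;
  star0 : S;
  sscaleA : forall (a b : R) (x : S), sscale a (sscale b x) = sscale (a * b) x;
  sscale1 : forall x : S, sscale 1 x = x;
  sscale0 : forall x : S, sscale 0 x = star0
}.

#[short(type="starType")]
HB.structure Definition Star (R : realType) := { S of isStar R S }.

Definition sopp (R : realType) (S : starType R) (x : S) : S := sscale (-1) x.

HB.mixin Record Star_isOrdered (R : realType) (d : Order.disp_t) S
    of Star R S & Order.POrder d S := {
  sle_scale : forall (a : R) (x y : S),
    0 <= a -> x <= y -> sscale a x <= sscale a y;
  sle_opp : forall x y : S, x <= y -> sopp y <= sopp x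
}.

#[short(type="orderedStarType")]
HB.structure Definition OrderedStar (R : realType) (d : Order.disp_t) :=
  { S of Star R S & Order.POrder d S & Star_isOrdered R d S }.

#[short(type="latticeStarType")]
HB.structure Definition LatticeStar (R : realType) (d : Order.disp_t) :=
  { S of OrderedStar R d S & Order.Lattice d S }.

Section LatticeStars.
Context (R : realType) (d : Order.disp_t) (S : latticeStarType R d).
Implicit Types x y z : S.

Definition spos x : S := x `|` star0.
Definition sneg x : S := sopp (x `&` star0).
Definition sabs x : S := x `|` sopp x.

Definition distributive_star : Prop :=
  forall x y z, x `&` (y `|` z) = (x `&` y) `|` (x `&` z).

Definition valuated : Prop := forall x, star0 <= sabs x.

End LatticeStars.

Arguments distributive_star {R d} S.
Arguments valuated {R d} S.

Definition lattice_star_hom (R : realType) (d d' : Order.disp_t)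
    (S : latticeStarType R d) (T : latticeStarType R d') (phi : S -> T) : Prop :=
  (forall (a : R) x, phi (sscale a x) = sscale a (phi x)) /\
  (forall x y, phi (x `|` y) = phi x `|` phi y).

(* The inclusion of a vector lattice E in S as a lattice substar. *)
Definition lattice_substar_embedding (R : realType) (dS : Order.disp_t)
    (E : vectorLatticeType R) (S : latticeStarType R dS)
    (iota : E -> S) : Prop :=
  [/\ injective iota,
      forall (a : R) x, iota (a *: x) = sscale a (iota x),
      forall x y, iota (x `|` y) = iota x `|` iota y
    & forall x y, iota (x `&` y) = iota x `&` iota y].

Section VectorLatticeInStar.
Context (R : realType) (dS : Order.disp_t).
Context (E : vectorLatticeType R) (S : latticeStarType R dS).
Variable iota : E -> S.

Definition joins_with : set S := [set u | exists s x, u = s `|` iota x].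

Definition pos_below (u : S) : set E := [set x | 0 <= x /\ iota x <= u].

(* [supremum x0 A] and [infimum x0 A] are the least upper and the greatest lower
   bound of A when there is one, and x0 otherwise.  Here the infima are over nonempty sets bounded below by [sopp (sneg s)]
   and the supremum is over a nonempty set bounded above by [spos s], so the
   default [star0] is not used when S is Dedekind complete. *)
Definition sup_inf_differences (s : S) : S :=
  supremum star0
    [set infimum star0 [set iota (x - y) | y in pos_below (sneg s)]
       | x in pos_below (spos s)].

End VectorLatticeInStar.

HB.mixin Record Nmodule_isCone (R : realType) C of GRing.Nmodule C := {
  cscale : {nonneg R} -> C -> C;
  cscaleDr : forall a (x y : C), cscale a (x + y) = cscale a x + cscale a y;
  cscaleDl : forall (a b : {nonneg R}) (x : C),
    cscale (a%:num + b%:num)%:nng x = cscale a x + cscale b x;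
  cscaleA : forall (a b : {nonneg R}) (x : C),
    cscale a (cscale b x) = cscale (a%:num * b%:num)%:nng x;
  cscale1 : forall x : C, cscale 1%:nng x = x;
  cscale0 : forall x : C, cscale 0%:nng x = 0
}.

#[short(type="coneType")]
HB.structure Definition Cone (R : realType) :=
  { C of GRing.Nmodule C & Nmodule_isCone R C }.

(* As for vector lattices, the order and the lattice operations are fields. *)
HB.mixin Record Cone_isLatticeCone (R : realType) C of Cone R C := {
  cle : rel C;
  cjoin : C -> C -> C;
  cmeet : C -> C -> C;
  cle_refl : reflexive cle;
  cle_anti : antisymmetric cle;
  cle_trans : transitive cle;
  clexI : forall x y z : C, cle x (cmeet y z) = cle x y && cle x z;
  cleUx : forall x y z : C, cle (cjoin x y) z = cle x z && cle y z;
  cle_add2r : forall z x y : C, cle x y -> cle (x + z) (y + z);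
  cle_scale : forall a (x y : C), cle x y -> cle (cscale a x) (cscale a y)
}.

#[short(type="latticeConeType")]
HB.structure Definition LatticeCone (R : realType) :=
  { C of Cone R C & Cone_isLatticeCone R C }.

HB.instance Definition _ (R : realType) (C : latticeConeType R) :=
  Order.Le_isPOrder.Build ring_display (LatticeCone.sort C)
    (@cle_refl R C) (@cle_anti R C) (@cle_trans R C).
HB.instance Definition _ (R : realType) (C : latticeConeType R) :=
  Order.POrder_MeetJoin_isLattice.Build ring_display (LatticeCone.sort C)
    (@clexI R C) (@cleUx R C).

Lemma lec_add2r (R : realType) (C : latticeConeType R) (z x y : C) :
  x <= y -> x + z <= y + z.
Proof. exact: cle_add2r. Qed.

Lemma lec_scale (R : realType) (C : latticeConeType R) a (x y : C) :
  x <= y -> cscale a x <= cscale a y.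
Proof. exact: cle_scale. Qed.

(* A lattice semistar homomorphism into (the lattice semistar underlying) a
   lattice cone C, defined on a lattice subsemistar D of S; the values of phi
   outside D are irrelevant.  When S is distributive, [joins_with iota] is such
   a D, as (s \/ x) /\ (t \/ y) = (((s \/ x) /\ t) \/ (s /\ y)) \/ (x /\ y). *)
Definition lattice_semistar_hom_on (R : realType) (dS : Order.disp_t)
    (S : latticeStarType R dS) (C : latticeConeType R)
    (D : set S) (phi : S -> C) : Prop :=
  [/\ forall (a : {nonneg R}) x, D x ->
        phi (sscale a%:num x) = cscale a (phi x),
      forall x y, D x -> D y -> phi (x `|` y) = phi x `|` phi y
    & forall x y, D x -> D y -> phi (x `&` y) = phi x `&` phi y].

(* [sc_inj] is the inclusion of E in its sup-completion C.  By [sc_sup]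
   and [sc_top], every nonempty subset of C has a supremum, so the default value
   0 is not used in [sc_sup_meet]. *)
Record sup_completion (R : realType) (E : vectorLatticeType R) := SupCompletion {
  sc_cone :> latticeConeType R;
  sc_inj : E -> sc_cone;
  sc_sup : forall A : set sc_cone,
    A !=set0 -> has_ubound A -> supremums A !=set0;
  sc_inf : forall A : set sc_cone,
    A !=set0 -> has_lbound A -> infimums A !=set0;
  sc_inj_inj : injective sc_inj;
  sc_invertible : range sc_inj = [set y | exists z : sc_cone, y + z = 0];
  sc_injD : forall x y : E, sc_inj (x + y) = sc_inj x + sc_inj y;
  sc_injZ : forall (a : {nonneg R}) (x : E),
    sc_inj (a%:num *: x) = cscale a (sc_inj x);
  sc_injU : forall x y : E, sc_inj (x `|` y) = sc_inj x `|` sc_inj y;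
  sc_injI : forall x y : E, sc_inj (x `&` y) = sc_inj x `&` sc_inj y;
  sc_dense : forall y : sc_cone,
    supremums [set sc_inj x | x in [set x | sc_inj x <= y]] y;
  sc_addI : forall (x : E) (y z : sc_cone),
    z + (sc_inj x `&` y) = (z + sc_inj x) `&` (z + y);
  sc_lower : forall (x : E) (y : sc_cone), y <= sc_inj x -> range sc_inj y;
  sc_top : exists t : sc_cone, forall y : sc_cone, y <= t;
  sc_sup_meet : forall A B : set sc_cone, A !=set0 -> B !=set0 ->
    supremum (0 : sc_cone) A = supremum (0 : sc_cone) B ->
    forall x : E, supremum (0 : sc_cone) [set a `&` sc_inj x | a in A] =
                  supremum (0 : sc_cone) [set b `&` sc_inj x | b in B]
}.

Section SupCompletionTheory.
Context (R : realType) (E : vectorLatticeType R).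
Variable C : sup_completion E.
Implicit Types x y z w : C.

Local Notation inj := (@sc_inj R E C).

Lemma sc_le_dense x y :
  (forall e : E, inj e <= x -> inj e <= y) -> x <= y.
Proof.
move=> H; have [_ lub] := sc_dense x.
by apply: lub => _ [e /= ex <-]; exact: H.
Qed.

Lemma sc_meet_joinE x y (e : E) :
  (x `|` y) `&` inj e = (x `&` inj e) `|` (y `&` inj e).
Proof.
have sup1 z : supremum (0 : C) [set z] = z by rewrite supremum1.
have sup2 z w : supremum (0 : C) [set z; w] = z `|` w.
  rewrite /supremum ifF; last by apply/negbTE/set0P; exists z; left.
  have lub : supremums [set z; w] (z `|` w).
    split; first by move=> t [] ->; rewrite ?leUl ?leUr.
    by move=> t ub; rewrite leUx !ub //; [right | left].
  case: xgetP => [t _ tlub|/(_ _ lub)//].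
  by apply: (is_subset1_supremums tlub).
have A0 : [set x; y] !=set0 by exists x; left.
have B0 : [set x `|` y] !=set0 by exists (x `|` y).
have := sc_sup_meet A0 B0; rewrite sup1 sup2 => /(_ erefl e).
by rewrite image_set1 sup1 image_setU !image_set1 sup2 => ->.
Qed.

Lemma sc_meetUl x y z : (x `|` y) `&` z = (x `&` z) `|` (y `&` z).
Proof.
apply/le_anti/andP; split; last first.
  by rewrite leUx !lexI !leIr /= andbT !(le_trans (leIl _ _)) ?leUl ?leUr.
apply: sc_le_dense => e; rewrite lexI => /andP[exy ez].
rewrite -(meet_idPr exy) sc_meet_joinE.
by apply: leU2; apply: leI2.
Qed.

Lemma cscaler0 a : cscale a 0 = 0 :> C.
Proof.
rewrite -[in LHS](cscale0 0) cscaleA.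
rewrite [X in cscale X](_ : _ = 0%:nng) ?cscale0 //.
by apply/val_inj => /=; rewrite mulr0.
Qed.

Lemma cscale_ge0 a x : (0 : C) <= x -> (0 : C) <= cscale a x.
Proof. by move=> /(lec_scale a); rewrite cscaler0. Qed.

Lemma cscale_meet0 a x y : x `&` y = 0 -> cscale a x `&` cscale a y = 0.
Proof.
move=> xy0; have [x0 y0] : (0 : C) <= x /\ (0 : C) <= y by rewrite -xy0 leIl leIr.
apply/le_anti; rewrite lexI !cscale_ge0 // !andbT.
have [a0|a0] := eqVneq a 0%:nng; first by rewrite a0 !cscale0 meetxx.
have b0 : (0 : R) <= a%:num^-1 by rewrite invr_ge0.
pose b : {nonneg R} := NngNum b0.
have a0' : a%:num != 0 by apply: contra_neq a0 => a0; exact/val_inj.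
have ba z : cscale b (cscale a z) = z.
  rewrite cscaleA -[RHS]cscale1; congr cscale.
  by apply/val_inj => /=; rewrite mulVf.
have ab z : cscale a (cscale b z) = z.
  rewrite cscaleA -[RHS]cscale1; congr cscale.
  by apply/val_inj => /=; rewrite mulfV.
rewrite -[leLHS]ab -[leRHS](cscaler0 a); apply: lec_scale.
rewrite -xy0 lexI; apply/andP; split.
  by rewrite -[leRHS]ba; apply: lec_scale; exact: leIl.
by rewrite -[leRHS]ba; apply: lec_scale; exact: leIr.
Qed.

End SupCompletionTheory.

Section SupInfCompletion.
Context (R : realType) (E : vectorLatticeType R).
Variable C : sup_completion E.

(* A pair (x, y) stands for the formal difference x - y. *)
Record sup_inf_completion := SupInf {
  si_val : C * C;
  _ : [&& (0 : C) <= si_val.1, (0 : C) <= si_val.2 & si_val.1 `&` si_val.2 == 0]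
}.

HB.instance Definition _ := [isSub for si_val].
HB.instance Definition _ := [Choice of sup_inf_completion by <:].

Implicit Types p q r : sup_inf_completion.

Definition si_le p q : bool :=
  ((val p).1 <= (val q).1) && ((val q).2 <= (val p).2).

Lemma si_le_refl : reflexive si_le.
Proof. by move=> p; rewrite /si_le !lexx. Qed.

Lemma si_le_anti : antisymmetric si_le.
Proof.
move=> p q /andP[/andP[le1 le2] /andP[ge1 ge2]].
apply/val_inj; rewrite [LHS]surjective_pairing [RHS]surjective_pairing.
by congr pair; apply/le_anti/andP.
Qed.

Lemma si_le_trans : transitive si_le.
Proof.
move=> q p r /andP[pq1 pq2] /andP[qr1 qr2].
by rewrite /si_le (le_trans pq1 qr1) (le_trans qr2 pq2).
Qed.

HB.instance Definition _ := Order.Le_isPOrder.Build ring_display sup_inf_completion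
  si_le_refl si_le_anti si_le_trans.

Lemma si_leE p q :
  (p <= q) = ((val p).1 <= (val q).1) && ((val q).2 <= (val p).2).
Proof. by []. Qed.

Lemma si_join_subproof p q :
  let u := ((val p).1 `|` (val q).1, (val p).2 `&` (val q).2) in
  [&& (0 : C) <= u.1, (0 : C) <= u.2 & u.1 `&` u.2 == 0].
Proof.
case: p q => [[x y] /= /and3P[x0 y0 /eqP xy]] [[z w] /= /and3P[z0 w0 /eqP zw]].
rewrite lexI y0 w0 (le_trans x0 (leUl _ _)) /= sc_meetUl.
by rewrite meetA xy (meetC y w) meetA zw (meet_idPl w0) (meet_idPl y0) joinxx.
Qed.

Definition si_join p q : sup_inf_completion := SupInf (si_join_subproof p q).

Lemma si_opp_subproof p :
  let u := ((val p).2, (val p).1) in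
  [&& (0 : C) <= u.1, (0 : C) <= u.2 & u.1 `&` u.2 == 0].
Proof. by case: p => [[x y] /= /and3P[-> ->]]; rewrite meetC. Qed.

Definition si_opp p : sup_inf_completion := SupInf (si_opp_subproof p).

Definition si_meet p q : sup_inf_completion :=
  si_opp (si_join (si_opp p) (si_opp q)).

Lemma si_lexI p q r : (p <= si_meet q r) = (p <= q) && (p <= r).
Proof. by rewrite !si_leE /= lexI leUx andbACA. Qed.

Lemma si_leUx p q r : (si_join p q <= r) = (p <= r) && (q <= r).
Proof. by rewrite !si_leE /= lexI leUx andbACA. Qed.

HB.instance Definition _ := Order.POrder_MeetJoin_isLattice.Build ring_display
  sup_inf_completion si_lexI si_leUx.

Lemma si_scale_subproof (a : {nonneg R}) p :
  let u := (cscale a (val p).1, cscale a (val p).2) in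
  [&& (0 : C) <= u.1, (0 : C) <= u.2 & u.1 `&` u.2 == 0].
Proof.
case: p => [[x y] /= /and3P[x0 y0 /eqP xy]].
by rewrite !cscale_ge0 //= cscale_meet0.
Qed.

Definition si_nnscale (a : {nonneg R}) p : sup_inf_completion :=
  SupInf (si_scale_subproof a p).

Definition si_scale (a : R) p : sup_inf_completion :=
  if 0 <= a then si_nnscale `|a|%:nng p else si_opp (si_nnscale `|a|%:nng p).

Lemma si0_subproof :
  let u := (0, 0) : C * C in [&& (0 : C) <= u.1, (0 : C) <= u.2 & u.1 `&` u.2 == 0].
Proof. by rewrite /= !lexx meetxx eqxx. Qed.

Definition si0 : sup_inf_completion := SupInf si0_subproof.

Lemma si_oppK : involutive si_opp.
Proof. by move=> p; apply/val_inj => /=; rewrite -surjective_pairing. Qed.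

Lemma si_nnscaleA (a b : {nonneg R}) (c : {nonneg R}) p :
  c%:num = a%:num * b%:num -> si_nnscale a (si_nnscale b p) = si_nnscale c p.
Proof.
move=> cE; have -> : c = (a%:num * b%:num)%:nng by exact/val_inj.
by apply/val_inj; rewrite /= !cscaleA.
Qed.

Lemma si_nnscaleN a p : si_nnscale a (si_opp p) = si_opp (si_nnscale a p).
Proof. exact/val_inj. Qed.

Lemma si_scaleA (a b : R) p : si_scale a (si_scale b p) = si_scale (a * b) p.
Proof.
have nnA := @si_nnscaleA `|a|%:nng `|b|%:nng `|a * b|%:nng _ (normrM a b).
have [->|a0] := eqVneq a 0.
  rewrite mul0r /si_scale lexx; apply/val_inj => /=.
  by rewrite [`|0|%:nng](_ : _ = 0%:nng) ?cscale0 //; apply/val_inj; exact: normr0.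
have [->|b0] := eqVneq b 0.
  have z q : si_nnscale `|0|%:nng q = si0.
    apply/val_inj => /=.
    rewrite [`|0|%:nng](_ : _ = 0%:nng) ?cscale0 //; apply/val_inj; exact: normr0.
  rewrite mulr0 /si_scale lexx !z; case: ifP => _; apply/val_inj; rewrite /= !cscaler0 //.
rewrite /si_scale; case: (leP 0 a) => ha; case: (leP 0 b) => hb.
- by rewrite mulr_ge0.
- have {}ha : 0 < a by rewrite lt_neqAle eq_sym a0.
  by rewrite pmulr_rge0 // leNgt hb /= si_nnscaleN nnA.
- have {}hb : 0 < b by rewrite lt_neqAle eq_sym b0.
  by rewrite pmulr_lge0 // leNgt ha /= nnA.
- by rewrite mulr_le0 ?ltW // si_nnscaleN si_oppK nnA.
Qed.

Lemma si_scale1 p : si_scale 1 p = p.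
Proof.
rewrite /si_scale ler01; apply/val_inj => /=.
rewrite [`|1|%:nng](_ : _ = 1%:nng) ?cscale1 -?surjective_pairing //.
by apply/val_inj; exact: normr1.
Qed.

Lemma si_scale0 p : si_scale 0 p = si0.
Proof.
rewrite /si_scale lexx; apply/val_inj => /=.
rewrite [`|0|%:nng](_ : _ = 0%:nng) ?cscale0 //.
by apply/val_inj; exact: normr0.
Qed.

HB.instance Definition _ := isStar.Build R sup_inf_completion
  si_scaleA si_scale1 si_scale0.

Lemma si_le_scale (a : R) p q :
  0 <= a -> p <= q -> sscale a p <= sscale a q.
Proof.
move=> a0; rewrite !si_leE => /andP[le1 le2].
by rewrite /sscale /= /si_scale a0 /= !lec_scale.
Qed.

Lemma si_le_opp p q : p <= q -> sopp q <= sopp p.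
Proof.
have N1 r : sopp r = si_opp r.
  rewrite /sopp /sscale /= /si_scale oppr_ge0 ler10; apply/val_inj => /=.
  rewrite [`|-1|%:nng](_ : _ = 1%:nng) ?cscale1 //.
  by apply/val_inj; rewrite /= normrN1.
by rewrite !N1 !si_leE /= andbC.
Qed.

HB.instance Definition _ := Star_isOrdered.Build R ring_display sup_inf_completion
  si_le_scale si_le_opp.

End SupInfCompletion.

(* Main.v *)
Require Import Defs.
From mathcomp Require Import all_boot all_order all_algebra.
From mathcomp Require Import boolp classical_sets reals.
From mathcomp Require Import interval_inference.

(** If [phi] is the homomorphism of (i), the embedding is
    [s |-> (phi s^+, phi s^-)].  It takes values in the sup-inf-completion
    because [s^+ /\ s^- = 0], which is where valuatedness and distributivity
    enter; it is injective because the right-hand side of (ii) depends on [s]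
    only through [s^+] and [s^-]. *)

Import Order.TTheory GRing.Theory Num.Theory.

Local Open Scope ring_scope.
Local Open Scope order_scope.

Section LatticeStarTheory.
Context (R : realType) (d : Order.disp_t) (S : latticeStarType R d).
Implicit Types (a : R) (s t : S).

Lemma sscaler0 a : sscale a star0 = star0 :> S.
Proof. by rewrite -[in LHS](sscale0 star0) sscaleA mulr0 sscale0. Qed.

Lemma sopp0 : sopp star0 = star0 :> S.
Proof. exact: sscaler0. Qed.

Lemma soppK : involutive (@sopp R S).
Proof. by move=> s; rewrite /sopp sscaleA mulrNN mulr1 sscale1. Qed.

Lemma sle_oppl s t : (sopp s <= t) = (sopp t <= s).
Proof. by apply/idP/idP => /sle_opp; rewrite soppK. Qed.

(** Negation is an order-reversing involution, so it exchanges meets and joins. *)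
Lemma soppI s t : sopp (s `&` t) = sopp s `|` sopp t.
Proof.
apply/le_anti/andP; split.
  by rewrite sle_oppl lexI !(sle_oppl (_ `|` _)) leUl leUr.
by rewrite leUx !sle_opp ?leIl ?leIr.
Qed.

Lemma soppU s t : sopp (s `|` t) = sopp s `&` sopp t.
Proof. by rewrite -[RHS]soppK soppI !soppK. Qed.

(** For [a > 0], scaling by [a] is an order automorphism with inverse scaling by [a^-1]; the case
    [a = 0] collapses to [star0]. *)
Lemma sscaleU a s t : 0 <= a -> sscale a (s `|` t) = sscale a s `|` sscale a t.
Proof.
move=> a0; have [->|a_neq0] := eqVneq a 0; first by rewrite !sscale0 joinxx.
have sscaleK u : sscale a (sscale a^-1 u) = u.
  by rewrite sscaleA divff // sscale1.
have sscaleVK u : sscale a^-1 (sscale a u) = u.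
  by rewrite sscaleA mulVf // sscale1.
apply/le_anti/andP; split; last by rewrite leUx !sle_scale ?leUl ?leUr.
rewrite -[leRHS]sscaleK; apply: sle_scale => //.
have aV0 : 0 <= a^-1 by rewrite invr_ge0.
rewrite leUx -{1}[s]sscaleVK -{2}[t]sscaleVK.
by rewrite !sle_scale ?leUl ?leUr.
Qed.

Lemma sscaleN a s : sscale (- a) s = sopp (sscale a s).
Proof. by rewrite /sopp sscaleA mulN1r. Qed.

Lemma sscale_sopp a s : sscale a (sopp s) = sopp (sscale a s).
Proof. by rewrite /sopp !sscaleA mulrC. Qed.

(** Lets facts about positive parts be reused for negative parts, including membership in
    [joins_with iota]. *)
Lemma snegE s : sneg s = spos (sopp s).
Proof. by rewrite /sneg soppI sopp0. Qed.

Lemma spos_scale a s : 0 <= a -> spos (sscale a s) = sscale a (spos s).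
Proof. by move=> a0; rewrite /spos sscaleU // sscaler0. Qed.

Lemma sneg_scale a s : 0 <= a -> sneg (sscale a s) = sscale a (sneg s).
Proof. by move=> a0; rewrite !snegE -sscale_sopp spos_scale. Qed.

Lemma sneg_opp s : sneg (sopp s) = spos s.
Proof. by rewrite snegE soppK. Qed.

Lemma sposU s t : spos (s `|` t) = spos s `|` spos t.
Proof. by rewrite /spos joinACA joinxx. Qed.

Hypothesis S_distributive : distributive_star S.

(** Distributivity splits the meet of the join with [star0]; negation then turns the resulting join
    into a meet. *)
Lemma snegU s t : sneg (s `|` t) = sneg s `&` sneg t.
Proof.
by rewrite /sneg meetC S_distributive soppU !(meetC star0).
Qed.

(** Distributing twice leaves only the meet of [s] and [sopp s] to bound by [star0]; its negation is
    [sabs s], nonnegative by valuatedness. *)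
Lemma spos_meet_sneg s : valuated S -> spos s `&` sneg s = star0.
Proof.
move=> S_valuated; apply/le_anti/andP; split; last first.
  by rewrite snegE lexI !leUr.
rewrite snegE S_distributive leUx leIr andbT.
rewrite meetC S_distributive leUx leIr andbT.
rewrite -[leLHS]soppK sle_oppl sopp0 soppI soppK.
exact: S_valuated.
Qed.

End LatticeStarTheory.

(** Together with [si_oppE], this reduces the star scaling of pairs to operations on coordinates, so
    that homogeneity can be checked componentwise. *)
Lemma si_scale_nneg {R : realType} {E : vectorLatticeType R}
    {C : sup_completion E} (a : {nonneg R}) (p : sup_inf_completion C) :
  sscale a%:num p = si_nnscale a p.
Proof.
rewrite /sscale /= /si_scale ge0; congr si_nnscale.
by apply/val_inj => /=; rewrite ger0_norm.
Qed.

Lemma si_oppE {R : realType} {E : vectorLatticeType R}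
    {C : sup_completion E} (p : sup_inf_completion C) : sopp p = si_opp p.
Proof.
rewrite /sopp /sscale /= /si_scale oppr_ge0 ler10; apply/val_inj => /=.
rewrite [`|-1|%:nng](_ : _ = 1%:nng) ?cscale1 //.
by apply/val_inj; rewrite /= normrN1.
Qed.

Theorem corollary4p3 (R : realType) (dS : Order.disp_t)
    (E : vectorLatticeType R) (Es : sup_completion E)
    (S : latticeStarType R dS) (iota : E -> S)
    (E_complete : dedekind_complete E)
    (S_complete : dedekind_complete S)
    (S_distributive : distributive_star S)
    (S_valuated : valuated S)
    (iota_substar : lattice_substar_embedding iota)
    (hyp_i : exists phi : S -> Es,
       lattice_semistar_hom_on (joins_with iota) phi /\
       {in joins_with iota &, injective phi})
    (hyp_ii : forall s : S, s = sup_inf_differences iota s) :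
  exists phi : S -> sup_inf_completion Es,
    lattice_star_hom phi /\ injective phi.
Proof.
have [_ iotaZ _ _] := iota_substar.
have [phi [[phiZ phiU phiI] phi_inj]] := hyp_i.
have iota0 : iota 0 = star0 by rewrite -(scale0r (0 : E)) iotaZ sscale0.
(* [phi] is controlled only on [joins_with iota], which need not contain [s] itself; its positive
   part is there as the join of [s] with [iota 0]. *)
have dom_pos s : joins_with iota (spos s) by exists s, 0; rewrite iota0.
have dom_neg s : joins_with iota (sneg s) by rewrite snegE.
have dom0 : joins_with iota star0.
  by exists star0, 0; rewrite iota0 joinxx.
have phi0 : phi star0 = 0.
  by rewrite -(sscale0 star0) (phiZ 0%:nng) // cscale0.
(* Joining [spos s] with [star0] changes nothing, and [phi] preserves this join, so the image
   dominates [phi star0]. *)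
have phi_pos_ge0 s : (0 : Es) <= phi (spos s).
  have <- : phi (spos s) `|` phi star0 = phi (spos s).
    by rewrite -phiU // /spos -joinA joinxx.
  by rewrite phi0 leUr.
have pairP s : [&& (0 : Es) <= (phi (spos s), phi (sneg s)).1,
    (0 : Es) <= (phi (spos s), phi (sneg s)).2
    & (phi (spos s), phi (sneg s)).1 `&` (phi (spos s), phi (sneg s)).2 == 0].
  by rewrite /= phi_pos_ge0 snegE phi_pos_ge0 -snegE -phiI // spos_meet_sneg
     // phi0 eqxx.
pose psi s : sup_inf_completion Es := SupInf (pairP s).
(* Every real scalar is nonnegative or the negative of a nonnegative one: the former act
   coordinatewise, and [-1] swaps the coordinates. *)
have psi_nneg (a : {nonneg R}) s : psi (sscale a%:num s) = sscale a%:num (psi s).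
  rewrite si_scale_nneg; apply/val_inj => /=.
  by rewrite spos_scale // sneg_scale // !phiZ.
have psi_opp s : psi (sopp s) = sopp (psi s).
  by rewrite si_oppE; apply/val_inj; rewrite /= -snegE sneg_opp.
exists psi; split; first split=> [a s|s t].
- have [a0|/ltW a0] := leP 0 a; first exact: (psi_nneg (NngNum a0)).
  have Na0 : 0 <= - a by rewrite oppr_ge0.
  by rewrite -[a]opprK !(sscaleN _ _ _ (- a)) psi_opp (psi_nneg (NngNum Na0)).
(* The order is reversed on second coordinates, so a join of pairs takes the meet there, matching
   [snegU]. *)
- by apply/val_inj; rewrite /= sposU snegU // phiU // phiI.
(* Both parts lie in [joins_with iota], where [phi] is injective, so equal images force equal
   parts. *)
- move=> s t [eq_pos eq_neg].
  rewrite (hyp_ii s) (hyp_ii t) /sup_inf_differences.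
  have -> : spos s = spos t by apply: phi_inj; rewrite ?inE.
  by have -> : sneg s = sneg t by apply: phi_inj; rewrite ?inE.
Qed.
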